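(* Let $G$ be a finite group and $F$ a field whose characteristic does not divide $|G|$. The following are equivalent: (i) $G$ is a Dedekind group; (ii) every irreducible $F$-representation of $G$ is fixed-point-free; (iii) the image $\rho(G)$ under every irreducible $F$-representation $\rho$ of $G$ is a Frobenius complement.
   Context: A Dedekind group is a group all of whose subgroups are normal. A representation $\rho$ is fixed-point-free if for every $g\in G$ either $\rho(g)$ is the identity or $\rho(g)$ has no non-zero fixed vector. A Frobenius complement is a group occurring as a complement $H$ in a Frobenius group $H\ltimes K$ (every element outside $K$ conjugate into $H$); equivalently, a finite group admitting a faithful fixed-point-free representation. *)

(* Defs.v *)
From mathcomp Require Import all_boot all_order all_algebra all_fingroup all_solvable all_character.
Set Implicit Arguments. Unset Strict Implicit. Unset Printing Implicit Defensive.
Import GRing.Theory.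
Local Open Scope group_scope.

Definition dedekind_group (gT : finGroupType) (G : {group gT}) : Prop :=
  forall H : {group gT}, H \subset G -> H <| G.

Definition fpf_repr (F : fieldType) (gT : finGroupType) (G : {group gT})
    (n : nat) (rG : mx_representation F G n) : Prop :=
  forall g, g \in G ->
    rG g = (1%:M)%R \/ (forall v : 'rV[F]_n, (v *m rG g)%R = v -> v = 0%R).

(* A finite group H is a Frobenius complement if it is (isomorphic to) the
   complement in a Frobenius group; the trivial group is included (it is the
   degenerate complement K ⋊ 1, and it admits a faithful fixed-point-free
   representation).  Frobenius groups are those of mathcomp's frobenius.v. *)
Definition frobenius_complement (hT : finGroupType) (H : {group hT}) : Prop :=
  H :=: 1 \/
  exists (lT : finGroupType) (L K M : {group lT}),
    [Frobenius L = K ><| M] /\ (M \isog H).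

(* Main.v *)
Require Import Defs.
From mathcomp Require Import all_boot all_order all_algebra all_fingroup all_solvable all_character.
Set Implicit Arguments. Unset Strict Implicit. Unset Printing Implicit Defensive.
Import GroupScope GRing.Theory.
Local Open Scope group_scope.

(* If <g> is normal in G, the fixed space of g is a submodule, so an irreducible
   representation either kills g or has no nonzero vector fixed by g: this
   gives (i) => (ii).  Conversely, for h in G and g in G the element
   e (h^g - 1) of the group ring, with e the sum of <h>, is killed by every
   fixed-point-free irreducible representation, hence vanishes by Maschke, which
   says that h^g lies in <h>.

   For (ii) => (iii), a Dedekind group H with a faithful fixed-point-free
   representation has a unique subgroup of order p for each prime p dividing
   |H|.  This no longer mentions F, and implies that H has a faithful irreducible
   representation over 'F_q for a prime q > |H|; it is fixed-point-free, and the
   resulting semidirect product is a Frobenius group.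

   For (iii) => (i), induct on |G|: proper quotients are Dedekind, and we may
   assume that G is itself a Frobenius complement.  Then G has a normal subgroup
   N of prime order (generated by the unique involution if |G| is even; obtained
   from the cyclic Sylow subgroups if |G| is odd).  For P of prime order, N P is
   normal because G / N is Dedekind, and cyclic because subgroups of order pq of a
   Frobenius complement are cyclic, so P is normal in G.  Hence every faithful
   irreducible representation of G is fixed-point-free, and (ii) yields (i). *)

(** * Fixed-point-free representations of Dedekind groups *)

Definition semireg_repr (F : fieldType) (gT : finGroupType) (G : {group gT})
    (n : nat) (rG : mx_representation F G n) : Prop :=
  forall g, g \in G^# -> forall v : 'rV[F]_n, (v *m rG g)%R = v -> v = 0%R.

Lemma fpf_faithful_semireg (F : fieldType) (gT : finGroupType) (G : {group gT})
    (n : nat) (rG : mx_representation F G n) :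
  fpf_repr rG -> mx_faithful rG -> semireg_repr rG.
Proof.
move=> fpfG /subsetP ffG g /setD1P[ntg Gg]; case: (fpfG g Gg) => // rg1.
by case/negP: ntg; rewrite -in_set1 ffG //; apply/rkerP.
Qed.

Lemma irr_normal_cycle_fpf (F : fieldType) (gT : finGroupType) (G : {group gT})
    (n : nat) (rG : mx_representation F G n) (g : gT) :
    mx_irreducible rG -> <[g]> <| G ->
  rG g = 1%:M%R \/ (forall v : 'rV[F]_n, (v *m rG g)%R = v -> v = 0%R).
Proof.
move=> /mx_irrP[_ irrG] nsgG.
have Gg : g \in G by rewrite (subsetP (normal_sub nsgG)) ?cycle_id.
have modV := normal_rfix_mx_module rG nsgG.
have [V0 | ntV] := eqVneq (rfix_mx rG <[g]>) 0%R.
  right=> v vg; apply/eqP; rewrite -submx0 -V0; apply/rfix_mxP=> x /cycleP[i ->].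
  elim: i => [|i IHi]; first by rewrite repr_mx1 mulmx1.
  by rewrite expgSr repr_mxM ?groupX // mulmxA IHi.
left; have := irrG _ modV ntV; rewrite -sub1mx => /rfix_mxP/(_ g (cycle_id g)).
by rewrite mul1mx.
Qed.

Lemma dedekind_irr_fpf (F : fieldType) (gT : finGroupType) (G : {group gT})
    (n : nat) (rG : mx_representation F G n) :
  dedekind_group G -> mx_irreducible rG -> fpf_repr rG.
Proof.
move=> dedG irrG g Gg; apply: irr_normal_cycle_fpf => //.
by apply: (dedG <[g]>%G); rewrite cycle_subG.
Qed.

(** * The group ring and (ii) => (i) *)

Lemma gring_mx_sum (F : fieldType) (gT : finGroupType) (G : {group gT})
    (n : nat) (rG : mx_representation F G n) (a : 'rV[F]_#|G|) :
  gring_mx rG a = (\sum_i a 0 i *: rG (enum_val i))%R.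
Proof.
rewrite /gring_mx /= mulmx_sum_row linear_sum; apply: eq_bigr => i _.
by rewrite linearZ /= rowK mxvecK.
Qed.

Lemma val_submod_gring_mx (F : fieldType) (gT : finGroupType) (G : {group gT})
    (n : nat) (rG : mx_representation F G n) (U : 'M[F]_n)
    (modU : mxmodule rG U) (m : nat) (W : 'M[F]_(m, \rank U)) (a : 'rV[F]_#|G|) :
  val_submod (W *m gring_mx (submod_repr modU) a)%R =
    (val_submod W *m gring_mx rG a)%R.
Proof.
rewrite !gring_mx_sum !mulmx_sumr linear_sum; apply: eq_bigr => i _.
by rewrite -!scalemxAr linearZ /= val_submodJ ?enum_valP.
Qed.

(** If [a] kills every simple summand of the regular module, it kills the whole module; but its
    action on the identity element returns [a]. *)
Lemma irr_separate (F : fieldType) (gT : finGroupType) (G : {group gT})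
    (a : 'rV[F]_#|G|) :
    mxsemisimple (regular_repr F G) 1%:M%R -> a != 0%R ->
  exists n (rG : mx_representation F G n),
    mx_irreducible rG /\ gring_mx rG a != 0%R.
Proof.
case=> I W /= simW defW _ nza.
have modW i : mxmodule (regular_repr F G) (W i) by case: (simW i).
have [i nzi | a0] :=
    pickP (fun i => gring_mx (submod_repr (modW i)) a != 0%R).
  by exists (\rank (W i)), (submod_repr (modW i)); split=> //; apply/submod_mx_irr.
case/eqP: nza; rewrite -[a](gring_mxK).
suffices ->: gring_mx (regular_repr F G) a = 0%R by rewrite linear0.
apply/eqP; rewrite -submx0 -[X in (X <= _)%MS]mul1mx -(eqmxMr _ defW).
rewrite sumsmxMr_gen; apply/sumsmx_subP=> i _; rewrite genmxE.
rewrite -(eqmxMr _ (val_submod1 _)) -(val_submod_gring_mx (modW i)).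
by have /negbFE/eqP-> := a0 i; rewrite mulmx0 linear0 submx0.
Qed.

Lemma gring_row_coeff (F : fieldType) (gT : finGroupType) (G : {group gT}) :
  {in G &, forall x z,
    gring_row (regular_repr F G x) 0%R (gring_index G z) = (z == x)%:R%R}.
Proof.
move=> x z Gx Gz; rewrite /gring_row mxE /= /regular_mx !mxE /=.
by rewrite gring_indexK // mul1g (can_in_eq (@gring_indexK _ G)).
Qed.

Lemma fpf_dedekind (F : fieldType) (gT : finGroupType) (G : {group gT}) :
    ([pchar F]%R)^'.-group G ->
    (forall (n : nat) (rG : mx_representation F G n),
        mx_irreducible rG -> fpf_repr rG) ->
  dedekind_group G.
Proof.
move=> chG fpfG H sHG; apply/andP; split=> //; apply/subsetP=> g Gg.
rewrite inE; apply/subsetP=> _ /imsetP[h Hh ->].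
have Gh := subsetP sHG h Hh; have Ghg : h ^ g \in G by rewrite groupJ.
suffices: h ^ g \in <[h]> by apply/subsetP; rewrite cycle_subG.
have sCG : <[h]> \subset G by rewrite cycle_subG.
have sC := subsetP sCG.
set C := <[h]> in sCG sC *; set y := h ^ g in Ghg *; pose aG := regular_repr F G.
(* Over an arbitrary [F] the decomposition into simples holds only under [classically], enough for a
   boolean goal. *)
apply: (mx_reducible_semisimple (mxmodule1 aG) (mx_Maschke_pchar aG chG)) => ssG.
pose S : 'M[F]_#|G| := (\sum_(c in C) aG c)%R.
pose a := (gring_row (S *m aG y - S)%R).
have [a0 | nza] := eqVneq a 0%R; last first.
  have [n [rG [irrG /eqP[]]]] := irr_separate ssG nza.
  rewrite -[gring_mx rG a]/(gring_op rG (S *m aG y - S)%R).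
  have opS : gring_op rG S = (\sum_(c in C) rG c)%R.
    by rewrite linear_sum; apply: eq_bigr => c /sC Gc; rewrite [LHS]gring_opG.
  have opy : gring_op rG (aG y) = rG y by rewrite gring_opG.
  have -> : gring_op rG (S *m aG y - S)%R = (gring_op rG S *m rG y - gring_op rG S)%R.
    by rewrite -opy -gring_opM ?envelop_mx_id // -linearB.
  (* If [rG h] is the identity, so is [rG y]. Otherwise the rows of the image of [S] are fixed by
     [h], as [C * h = C], and so vanish. *)
  have [rh1 | fixh] := fpfG _ _ irrG h Gh.
    rewrite /y conjgE !repr_mxM ?groupV ?groupM // rh1 mul1mx.
    by rewrite -repr_mxM ?groupV // mulVg repr_mx1 mulmx1 subrr.
  suffices ->: gring_op rG S = 0%R by rewrite mul0mx subrr.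
  apply/row_matrixP=> i; rewrite row0; apply: fixh; rewrite -row_mul; congr row.
  rewrite opS mulmx_suml [RHS](reindex_inj (mulIg h)); apply: eq_big => [c|c Cc].
    by rewrite groupMr ?cycle_id.
  by rewrite repr_mxM // sC.
(* In the coefficient of [y] in [a], the terms [c * y] contribute 1, from [c = 1] alone; the terms
   [c] subtract 1 exactly when [y] lies in [C]. *)
have /eqP := congr1 (fun b : 'rV[F]_#|G| => b 0%R (gring_index G y)) a0.
have ->: a = (\sum_(c in C) (gring_row (aG (c * y)%g) - gring_row (aG c)))%R.
  rewrite /a /S mulmx_suml -sumrB linear_sum; apply: eq_bigr => c /sC Gc.
  by rewrite -repr_mxM // linearB.
have coef z : z \in G -> gring_row (aG z) 0%R (gring_index G y) = (y == z)%:R%R.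
  by move=> Gz; rewrite gring_row_coeff.
rewrite sumrB mxE !summxE [X in (_ + X)%R]mxE summxE mxE subr_eq0 (bigD1 1) //= mul1g.
rewrite coef // eqxx big1 => [|c /andP[Cc nt_c]]; last first.
  rewrite coef ?(groupM (sC c Cc)) //; have [/(canLR (mulgK y)) | //] := y =P c * y.
  by rewrite mulgV => c1; rewrite -c1 eqxx in nt_c.
apply: contraLR => nCy; rewrite big1 ?addr0 ?oner_eq0 // => c Cc.
by rewrite coef ?sC //; case: eqP nCy => // ->; rewrite Cc.
Qed.

(** * Semiregular representations and subgroups of prime order *)

Lemma semireg_subg (F : fieldType) (gT : finGroupType) (G H : {group gT})
    (n : nat) (rG : mx_representation F G n) (sHG : H \subset G) :
  semireg_repr rG -> semireg_repr (subg_repr rG sHG).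
Proof. by move=> regG g Hg; apply: regG; apply: (subsetP (setSD _ sHG)). Qed.

(** A simple submodule is faithful, since an element trivial on it fixes a nonzero vector; an
    abelian group with a faithful irreducible representation is cyclic. For [n = 0] semiregularity
    is vacuous. *)
Lemma semireg_abelian_cyclic (F : fieldType) (gT : finGroupType)
    (G : {group gT}) (n : nat) (rG : mx_representation F G n) :
  0 < n -> semireg_repr rG -> abelian G -> cyclic G.
Proof.
move=> n_gt0 regG cGG.
have nz1 : 1%:M%R != 0%R :> 'M[F]_n by rewrite -mxrank_eq0 mxrank1 -lt0n.
apply: (mxsimple_exists (mxmodule1 rG) nz1) => -[V simV _].
have modV : mxmodule rG V by case: simV.
have irrV := (submod_mx_irr modV).2 simV.
apply: mx_faithful_irr_abelian_cyclic irrV cGG.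
apply/subsetP=> g; rewrite rker_submod !inE => /andP[Gg /eqP Vg].
case: simV => _ nzV _; apply: contraNT nzV => ntg; rewrite -submx0.
apply/rV_subP=> v /submxP[w ->]; rewrite submx0; apply/eqP.
by apply: regG (g) _ _ _; rewrite ?inE ?ntg // -mulmxA Vg.
Qed.

(** Distinct normal subgroups of prime order commute, so their join is abelian, hence cyclic, and a
    cyclic group has at most one subgroup of each order. *)
Lemma dedekind_semireg_prime_cycle (F : fieldType) (gT : finGroupType)
    (G : {group gT}) (n : nat) (rG : mx_representation F G n) :
    dedekind_group G -> 0 < n -> semireg_repr rG ->
  {in G &, forall x y, prime #[x] -> #[x] = #[y] -> <[x]> = <[y]>}.
Proof.
move=> dedG n_gt0 regG x y Gx Gy pr_x oxy.
have [sxG syG] : <[x]> \subset G /\ <[y]> \subset G by rewrite !cycle_subG.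
have nrm (z : gT) : z \in G -> G \subset 'N(<[z]>).
  by move=> Gz; apply: (normal_norm (dedG <[z]>%G _)); rewrite cycle_subG.
have [sxy | tixy] : <[x]> \subset <[y]> \/ <[y]> :&: <[x]> = 1.
- exact: prime_subgroupVti.
- by apply/eqP; rewrite eqEcard sxy -!orderE oxy /=.
have cxy : <[y]> \subset 'C(<[x]>).
  apply/commG1P/trivgP; rewrite -tixy subsetI.
  by rewrite commg_subl commg_subr (subset_trans sxG) ?(subset_trans syG) ?nrm.
have cEE : abelian (<[x]> <*> <[y]>) by rewrite abelianY !cycle_abelian.
have sEG : <[x]> <*> <[y]> \subset G by rewrite join_subG sxG.
have cycE := semireg_abelian_cyclic n_gt0 (semireg_subg (sHG := sEG) regG) cEE.
apply/eqP.
by rewrite (eq_subG_cyclic cycE) ?joing_subl ?joing_subr // -!orderE oxy.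
Qed.

(** * Existence of faithful irreducible representations *)

Lemma mul_regular_coeff (F : fieldType) (gT : finGroupType) (G : {group gT})
    (a : 'rV[F]_#|G|) :
  {in G &, forall x z, (a *m regular_repr F G x)%R 0%R (gring_index G z)
                       = a 0%R (gring_index G (z * x^-1))}.
Proof.
move=> x z Gx Gz; rewrite mxE (bigD1 (gring_index G (z * x^-1))) //=.
rewrite !mxE gring_indexK ?groupM ?groupV // mulgKV !eqxx mulr1.
rewrite big1 ?addr0 // => i; rewrite !mxE /= => /eqP ne_i.
case: eqP => [def_z | _]; last by rewrite mulr0.
case: ne_i; rewrite -[z](@gring_indexK _ G z Gz) def_z gring_indexK ?groupM ?enum_valP //.
by rewrite mulgK gring_valK.
Qed.

(* The row [a] is the product of the [x p - 1] for [p] in [s], and [Y] the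
   subgroup generated by the [x p].  If [a] vanished after the factor [x p - 1]
   is appended, then [a] would be invariant under [x p], which moves its support
   [Y] off itself. *)
Lemma prime_order_product (F : fieldType) (gT : finGroupType)
    (G : {group gT}) (x : nat -> gT) (s : seq nat) :
    uniq s ->
    (forall p, p \in s -> [/\ prime p, #[x p] = p & <[x p]> <| G]) ->
  exists (Y : {group gT}) (a : 'rV[F]_#|G|),
    [/\ Y \subset G, forall p, prime p -> p %| #|Y| -> p \in s, a != 0%R,
        {in G, forall z, z \notin Y -> a 0%R (gring_index G z) = 0%R}
      & forall p, p \in s -> forall n (rG : mx_representation F G n),
          rG (x p) = 1%:M%R -> gring_mx rG a = 0%R].
Proof.
elim: s => [|p s IHs] /= => [_ _ | /andP[nsp Us] xP].
  exists 1%G, (delta_mx 0 (gring_index G 1))%R; split=> //.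
  - exact: sub1G.
  - by move=> p; rewrite cards1 dvdn1 => + /eqP p1; rewrite p1.
  - apply/eqP=> /rowP/(_ (gring_index G 1))/eqP.
    by rewrite !mxE !eqxx oner_eq0.
  move=> z Gz nz1; rewrite mxE /= (can_in_eq (@gring_indexK _ G)) //.
  by case: eqP nz1 => // ->; rewrite group1.
have [q sq | Y [a [sYG piY nza supp_a kill_a]]] := IHs Us.
  by apply: xP; rewrite inE sq orbT.
have [pr_p ox nsxG] := xP p (mem_head _ _); set X := x p in ox nsxG.
have GX : X \in G by rewrite -cycle_subG normal_sub.
have nYX : X \notin Y.
  by apply: contra nsp => YX; apply: piY; rewrite // -ox order_dvdG.
exists (Y <*> <[X]>)%G, (a *m regular_repr F G X - a)%R; split.
- by rewrite join_subG sYG cycle_subG.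
- move=> q pr_q; rewrite /= norm_joinEl; last first.
    by apply: subset_trans sYG (normal_norm nsxG).
  move=> q_dv; have: q %| #|Y| * #|<[X]>|.
    by rewrite mul_cardG dvdn_mulr.
  rewrite inE Euclid_dvdM // -orderE ox => /orP[dvqY | ].
    by rewrite (piY q) ?orbT.
  by rewrite dvdn_prime2 // => ->.
- apply: contraNneq nza => /eqP; rewrite subr_eq0 => /eqP fix_a.
  apply/eqP/rowP=> i; rewrite mxE -[i](gring_valK (G := G)).
  set z := enum_val i; have Gz : z \in G by apply: enum_valP.
  have [Yz | /supp_a-> //] := boolP (z \in Y).
  have GzX : z * X^-1 \in G by rewrite groupM ?groupV.
  by rewrite -fix_a mul_regular_coeff // supp_a // groupMl ?groupV.
- move=> z Gz nYz; rewrite mxE [X in (_ + X)%R]mxE mul_regular_coeff //.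
  have GzX : z * X^-1 \in G by rewrite groupM ?groupV.
  rewrite !supp_a ?subr0 //.
    by apply: contra nYz; apply/subsetP; rewrite joing_subl.
  apply: contra nYz => YzX; rewrite -(mulgKV X z).
  by rewrite groupM ?mem_gen // inE ?YzX // cycle_id orbT.
move=> q; rewrite inE => q_s n rG rq1; rewrite linearB /= gring_mxJ //.
case/predU1P: q_s => [def_q | sq]; last by rewrite (kill_a q) // mul0mx subr0.
by rewrite /X -def_q rq1 mulmx1 subrr.
Qed.

(** Some irreducible representation does not kill the product of the [x p - 1]. Its kernel contains
    no [x p], hence by uniqueness no element of prime order. *)
Lemma faithful_irr_exists (F : decFieldType) (gT : finGroupType)
    (G : {group gT}) :
    ([pchar F]%R)^'.-group G ->
    {in G &, forall x y, prime #[x] -> #[x] = #[y] -> <[x]> = <[y]>} ->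
  exists n (rG : mx_representation F G n), mx_irreducible rG /\ mx_faithful rG.
Proof.
move=> chG uniqG.
pose x p := odflt 1 [pick x in G | #[x] == p].
have xP p : p \in primes #|G| -> [/\ prime p, x p \in G & #[x p] = p].
  rewrite mem_primes => /and3P[pr_p _ /Cauchy[]// y Gy oy]; split=> //.
    by rewrite /x; case: pickP => [z /andP[] //|]; rewrite group1.
  by rewrite /x; case: pickP => [z /andP[_ /eqP]//| /(_ y)]; rewrite Gy oy eqxx.
have [p /xP[pr_p Gx ox] | Y [a [_ _ nza _ kill_a]]] :=
    @prime_order_product F gT G x (primes #|G|) (primes_uniq _).
  split=> //; rewrite /normal cycle_subG Gx; apply/subsetP=> g Gg.
  by rewrite inE -cycleJ (uniqG _ (x p)) ?groupJ ?orderJ ?ox.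
have ssG : mxsemisimple (regular_repr F G) 1%:M%R.
  exact: (@dec_mx_reducible_semisimple F gT G _ (regular_repr F G) _
            (mxmodule1 _) (mx_Maschke_pchar _ chG)).
have [n [rG [irrG nz_ra]]] := irr_separate ssG nza.
exists n, rG; split=> //; rewrite /mx_faithful subG1 trivg_card1.
apply: contraR nz_ra => nt_ker; set p := pdiv #|rker rG|.
have pr_p : prime p by rewrite pdiv_prime // ltn_neqAle eq_sym nt_ker cardG_gt0.
have [y /rkerP[Gy ry1] oy] := Cauchy pr_p (pdiv_dvd _).
have Gp : p \in primes #|G|.
  by rewrite mem_primes pr_p cardG_gt0 -oy order_dvdG.
have [_ Gx ox] := xP p Gp; rewrite (kill_a p) //.
suffices /rkerP[] : x p \in rker rG by [].
rewrite -cycle_subG -(uniqG y (x p)) ?oy ?ox // cycle_subG.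
exact/rkerP.
Qed.

(** * Frobenius groups and semiregular representations *)

Lemma semireg_frobenius (p n : nat) (gT : finGroupType) (G : {group gT})
    (rG : mx_representation 'F_p G n) :
  0 < n -> semireg_repr rG -> frobenius_complement G.
Proof.
move=> n_gt0 regG; have [G1 | ntG] := eqVneq G 1%G; first by left; rewrite G1.
(* The Frobenius kernel is the additive group of row vectors, on which [G] acts by right
   multiplication through [rG]. *)
right; pose to := ('MR rG)%gact; have defL := sdprod_sdpair to.
exists (sdprod_by to), [group of [set: sdprod_by to]].
exists (sdpair1 to @* setT)%G, (sdpair2 to @* G)%G.
have isoG : G \isog sdpair2 to @* G by rewrite sub_isog ?injm_sdpair2.
split; last by rewrite isog_sym.
apply/Frobenius_semiregularP => //.
- apply/trivgPn; exists (sdpair1 to (const_mx 1%R)).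
    by rewrite mem_morphim ?inE.
  rewrite (morph_injm_eq1 (injm_sdpair1 to)) ?inE //.
  apply/eqP=> /rowP/(_ (Ordinal n_gt0))/eqP; rewrite !mxE oner_eq0 //.
- by rewrite trivg_card1 -(card_isog isoG) -trivg_card1.
move=> y /setD1P[+ /morphimP[g Gg _ def_y]].
rewrite def_y (morph_injm_eq1 (injm_sdpair2 to)) // => ntg.
apply/trivgP/subsetP=> _ /setIP[/morphimP[v Rv _ ->] /cent1P cvg].
have: sdpair1 to (to v g) = sdpair1 to v.
  by rewrite sdpair_act // conjgE cvg mulKg.
move/(injmP (injm_sdpair1 to)); rewrite !inE /= mx_repr_actE // => vg.
by rewrite (regG g _ v) ?morph1 ?inE ?ntg // vg.
Qed.

(** The coprime action of [E] on [K] leaves some Sylow subgroup [R] of [K] invariant, and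
    ['Ohm_1('Z(R))] is an ['F_p]-module for [E]. It is semiregular because nontrivial elements of
    [M] centralise no nontrivial element of [K]. *)
Lemma Frobenius_compl_repr (gT : finGroupType) (L K M E : {group gT}) :
    [Frobenius L = K ><| M] -> E \subset M -> solvable E ->
  exists p n (rE : mx_representation 'F_p E n),
    [/\ prime p, coprime p #|E|, 0 < n & semireg_repr rE].
Proof.
move=> frobL sEM solE; have regM := Frobenius_reg_ker frobL.
have [/sdprodP[_ _ nKM _] ntK _ _ _] := Frobenius_context frobL.
have coKE : coprime #|K| #|E| by apply: coprimegS sEM (Frobenius_coprime frobL).
set p := pdiv #|K|; have pr_p : prime p by rewrite pdiv_prime ?cardG_gt1.
have [R sylR nRE] :=
  @sol_coprime_Sylow_exists _ p _ _ solE (subset_trans sEM nKM) coKE.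
have pR := pHall_pgroup sylR; have sRK := pHall_sub sylR.
have ntR : R :!=: 1 by rewrite -rank_gt0 (rank_Sylow sylR) p_rank_gt0 pi_pdiv cardG_gt1.
set V := 'Ohm_1('Z(R))%G.
have pZ : p.-group 'Z(R) := pgroupS (center_sub R) pR.
have abelV : p.-abelem V by rewrite Ohm1_abelem ?center_abelian.
have ntV : V :!=: 1 by rewrite Ohm1_eq1 center_nil_eq1 ?(pgroup_nil pR).
have nVE : E \subset 'N(V).
  by apply: char_norm_trans nRE; apply: char_trans (Ohm_char 1 _) (center_char R).
have sVK : V \subset K.
  by apply: subset_trans sRK; apply: subset_trans (Ohm_sub 1 _) (center_sub R).
exists p, _, (abelem_repr abelV ntV nVE); split=> //.
  by apply: coprime_dvdl coKE; apply: pdiv_dvd.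
move=> g /setD1P[ntg Eg] v vg.
have Vv := mem_rVabelem abelV ntV v.
suffices: rVabelem abelV ntV v \in 'C_K[g].
  rewrite regM ?inE ?ntg ?(subsetP sEM) // => /eqP v1.
  by rewrite -[v](rVabelemK abelV ntV) v1 abelem_rV_1.
rewrite inE (subsetP sVK) //=; apply/cent1P/commgP/conjg_fixP.
by rewrite -(rVabelemJ abelV ntV nVE) // vg.
Qed.

Lemma Frobenius_compl_abelian_cyclic (gT : finGroupType) (L K M E : {group gT}) :
  [Frobenius L = K ><| M] -> E \subset M -> abelian E -> cyclic E.
Proof.
move=> frobL sEM cEE.
have [p [n [rE [_ _ n_gt0 regE]]]] :=
  Frobenius_compl_repr frobL sEM (abelian_sol cEE).
exact: semireg_abelian_cyclic n_gt0 regE cEE.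
Qed.

Lemma semireg_sum0 (F : fieldType) (gT : finGroupType) (G S : {group gT})
    (n : nat) (rG : mx_representation F G n) :
    semireg_repr rG -> S \subset G -> S :!=: 1 ->
  (\sum_(s in S) rG s = 0)%R.
Proof.
move=> regG sSG /trivgPn[g Sg ntg]; apply/row_matrixP=> i; rewrite row0.
have Gg := subsetP sSG g Sg.
apply: (regG g); first by rewrite !inE ntg.
rewrite -row_mul; congr row.
rewrite mulmx_suml [RHS](reindex_inj (mulIg g)); apply: eq_big => [s|s Ss].
  by rewrite groupMr.
by rewrite repr_mxM // (subsetP sSG).
Qed.

(* Sum [rG (x ^ j)] over [x] in [P] and [j] in [Q] in both orders: for [x != 1]
   the conjugates [x ^ j] run over the coset [x *: Q], whose sum is zero. *)
Lemma semireg_no_Frobenius (F : fieldType) (gT : finGroupType)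
    (G P Q : {group gT}) (n : nat) (rG : mx_representation F G n) :
    0 < n -> semireg_repr rG -> P \subset G -> Q \subset G -> P \subset 'N(Q) ->
    semiregular Q P -> P :!=: 1 -> Q :!=: 1 ->
  (#|Q|%:R = 0 :> F)%R.
Proof.
move=> n_gt0 regG sPG sQG nQP regQP ntP ntQ.
have [sP sQ] := (subsetP sPG, subsetP sQG).
have: (\sum_(j in Q) \sum_(x in P) rG (x ^ j)%g = 0)%R.
  rewrite big1 // => j Qj; transitivity (rG j^-1%g *m (\sum_(x in P) rG x) *m rG j)%R.
    rewrite mulmx_sumr mulmx_suml; apply: eq_bigr => x Px.
    have [Gx Gj] := (sP x Px, sQ j Qj).
    by rewrite conjgE mulgA !repr_mxM ?groupM ?groupV.
  by rewrite (semireg_sum0 regG) // mulmx0 mul0mx.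
rewrite exchange_big (bigD1 1) //= [X in (_ + X)%R]big1 => [|x /andP[Px ntx]].
  rewrite addr0; under eq_bigr do rewrite conj1g repr_mx1.
  rewrite sumr_const => /matrixP/(_ (Ordinal n_gt0) (Ordinal n_gt0)).
  by rewrite mulmxnE !mxE eqxx.
have Nx : x \in 'N(Q) := subsetP nQP x Px.
(* As ['C_Q[x]] is trivial, [j |-> [~ x, j]] is injective on [Q], hence onto; moreover [x ^ j = x *
   [~ x, j]]. *)
have defQ : [set [~ x, j] | j in Q] = Q.
  apply/eqP; rewrite eqEcard; apply/andP; split.
    apply/subsetP=> _ /imsetP[j Qj ->]; rewrite commgEr.
    by apply: groupM => //; rewrite memJ_norm ?groupV.
  rewrite card_in_imset // => j k Qj Qk /mulgI.
  move/(canLR (conjgK _)); rewrite -conjgM => xjk.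
  have: j * k^-1 \in 'C_Q[x].
    by rewrite inE groupM ?groupV // cent1C; apply/cent1P/commgP/conjg_fixP.
  by rewrite regQP ?inE ?ntx // -eq_mulgV1 => /eqP.
transitivity (rG x *m \sum_(j in Q) rG j)%R; last first.
  by rewrite (semireg_sum0 regG) // mulmx0.
rewrite -{2}defQ big_imset /=; last first.
  by apply/imset_injP; rewrite defQ.
rewrite mulmx_sumr; apply: eq_bigr => j Qj.
have [Gx Gj] := (sP x Px, sQ j Qj).
by rewrite -repr_mxM ?groupR // -conjg_mulR.
Qed.

(** Otherwise [P] acts semiregularly on [Q], and [semireg_no_Frobenius] makes the characteristic of
    the module divide [#|Q|], to which it is coprime. *)
Lemma Frobenius_compl_prime_cent (gT : finGroupType) (L K M P Q : {group gT}) :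
    [Frobenius L = K ><| M] -> P \subset M -> Q \subset M ->
    prime #|P| -> prime #|Q| -> P \subset 'N(Q) ->
  P \subset 'C(Q).
Proof.
move=> frobL sPM sQM pr_P pr_Q nQP.
have sEM : Q <*> P \subset M by rewrite join_subG sQM.
have [cycQ cycP] : cyclic Q /\ cyclic P by rewrite !prime_cyclic.
have solE : solvable (Q <*> P).
  have nsQE : Q <| Q <*> P by rewrite normalYl.
  rewrite (series_sol nsQE) abelian_sol ?cyclic_abelian //.
  by rewrite quotientYidl // quotient_sol // abelian_sol ?cyclic_abelian.
have [p [n [rE [pr_p co_p n_gt0 regE]]]] := Frobenius_compl_repr frobL sEM solE.
have [sQC | tiQC] : Q \subset 'C(P) \/ 'C(P) :&: Q = 1.
  exact: prime_subgroupVti.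
  by rewrite centsC.
have: (#|Q|%:R = 0 :> 'F_p)%R.
  apply: (semireg_no_Frobenius n_gt0 regE (joing_subr Q P) (joing_subl Q P)) => //.
  - move=> x /setD1P[ntx Px].
    have <- : 'C_Q(P) = 1 by rewrite setIC.
    have ->: P :=: <[x]>; last by rewrite cent_cycle.
    have [// | tiP] := prime_subgroupVti <[x]> pr_P.
      by move=> sPx; apply/eqP; rewrite eqEsubset sPx cycle_subG.
    have: x \in <[x]> :&: P by rewrite inE cycle_id.
    by rewrite tiP inE (negPf ntx).
  - by rewrite -cardG_gt1 prime_gt1.
  - by rewrite -cardG_gt1 prime_gt1.
move/eqP; rewrite -(dvdn_pcharf (pchar_Fp pr_p)) => dv_pQ.
by move: co_p; rewrite prime_coprime // (dvdn_trans dv_pQ) ?cardSg ?joing_subl.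
Qed.

(** * A normal subgroup of prime order in a Frobenius complement *)

Lemma Frobenius_compl_involution_uniq (gT : finGroupType) (L K M : {group gT}) :
    [Frobenius L = K ><| M] ->
  {in M &, forall t u, #[t] = 2 -> #[u] = 2 -> t = u}.
Proof.
move=> frobL t u Mt Mu ot ou; have regM := Frobenius_reg_ker frobL.
have [/sdprodP[_ _ nKM _] ntK _ _ _] := Frobenius_context frobL.
(* [k |-> k^-1 * k ^ z] is injective on [K], hence onto. *)
have invK z : z \in M -> #[z] = 2 -> {in K, forall k, k ^ z = k^-1}.
  move=> Mz oz; have Nz : z \in 'N(K) := subsetP nKM z Mz.
  have z2 : z * z = 1 by rewrite -expg2 -oz expg_order.
  have defK : [set [~ k, z] | k in K] = K.
    apply/eqP; rewrite eqEcard; apply/andP; split.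
      by apply/subsetP=> _ /imsetP[k Kk ->]; rewrite groupM ?groupV ?memJ_norm.
    rewrite card_in_imset // => j k Kj Kk eq_jk.
    apply/eqP; rewrite eq_mulgV1 -in_set1.
    have <- : 'C_K[z] = [set 1].
      by rewrite regM // !inE Mz andbT -order_gt1 oz.
    rewrite inE groupM ?groupV //=; apply/cent1P/commgP/conjg_fixP.
    move: eq_jk; rewrite !commgEl conjMg conjVg => eq_jk.
    have -> : j ^ z = j * (k^-1 * k ^ z) by rewrite -eq_jk mulKVg.
    by rewrite mulgA mulgK.
  move=> k; rewrite -defK => /imsetP[j Kj ->].
  by rewrite commgEl conjMg -conjgM z2 conjg1 invMg invgK conjVg.
have [k Kk ntk] := trivgPn _ ntK.
apply/eqP; rewrite eq_mulgV1; apply: contraR ntk => nt_tu.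
have u2 : u^-1 = u by apply/eqP; rewrite eq_invg_mul -expg2 -ou expg_order.
(* Both involutions invert [K], so their product centralises [K], which only the identity of [M]
   does. *)
suffices: k \in 'C_K[t * u^-1].
  by rewrite regM ?inE ?nt_tu ?groupM ?groupV // => /eqP->.
rewrite inE Kk; apply/cent1P/commgP/conjg_fixP.
by rewrite u2 conjgM !invK ?groupV // invgK.
Qed.

(* Induction from [n * p] to [n], [p] being the least prime factor of [n * p]:
   Frobenius' theorem gives #|'Ldiv_n(G)| = k * n, the elements of
   'Ldiv_(n * p)(G) outside 'Ldiv_n(G) have order divisible by [p], hence their
   number [(p - k) * n] is divisible by [p - 1], and [p - 1] is coprime to [n]. *)
Lemma card_Ldiv_upper (gT : finGroupType) (G : {group gT}) (n : nat) :
    Zgroup G -> n %| #|G| ->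
    (forall p q, p \in primes (#|G| %/ n) -> q \in primes n -> p <= q) ->
  #|'Ldiv_n(G)| = n.
Proof.
move=> ZG; have [m] := ubnP (#|G| %/ n); elim: m n => // m IHm n le_m dv_nG upn.
have G_gt0 := cardG_gt0 G; have n_gt0 : 0 < n := dvdn_gt0 G_gt0 dv_nG.
have [def_n | nt_n] := eqVneq (#|G| %/ n) 1%N.
  have def_G : n = #|G| by rewrite -(divnK dv_nG) def_n mul1n.
  suffices ->: 'Ldiv_n(G) = G by [].
  by apply/setIidPl/subsetP=> x Gx; rewrite inE def_G expg_cardG.
have Gn_gt0 : 0 < #|G| %/ n by rewrite divn_gt0 // dvdn_leq.
have Gn_gt1 : 1 < #|G| %/ n by rewrite ltn_neqAle eq_sym nt_n.
set p := max_pdiv (#|G| %/ n).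
have pr_p : prime p by rewrite max_pdiv_prime.
have p_dv : p %| #|G| %/ n by rewrite max_pdiv_dvd.
have dv_npG : n * p %| #|G| by rewrite -(divnK dv_nG) mulnC dvdn_mul.
have defGnp : #|G| %/ (n * p) = #|G| %/ n %/ p by rewrite divnMA.
have le_pn q : q \in primes n -> p <= q.
  by apply: upn; rewrite mem_primes pr_p p_dv ltnW.
have card_np : #|'Ldiv_(n * p)(G)| = (n * p)%N.
  apply: IHm => //.
    by rewrite defGnp; apply: leq_trans (ltn_Pdiv (prime_gt1 pr_p) Gn_gt0) _.
  move=> r q; rewrite defGnp => r_dv.
  have r_Gn : r \in primes (#|G| %/ n).
    move: r_dv; rewrite !mem_primes => /and3P[-> _ r_dv].
    by rewrite Gn_gt0 (dvdn_trans r_dv) ?dvdn_div.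
  rewrite primesM ?(prime_gt0 pr_p) // (primes_prime pr_p) inE => /orP[/upn-> // | /eqP->].
  exact: max_pdiv_max.
have /dvdnP[k card_n] := Frobenius_Ldiv dv_nG.
have sub_n : 'Ldiv_n(G) \subset 'Ldiv_(n * p)(G).
  apply/subsetP=> x; rewrite !inE => /andP[-> /eqP xn1].
  by rewrite expgM xn1 expg1n /=.
pose D := 'Ldiv_(n * p)(G) :\: 'Ldiv_n(G).
have card_D : #|D| = ((p - k) * n)%N.
  by rewrite cardsD (setIidPr sub_n) card_np card_n mulnBl mulnC.
(* A cyclic Sylow subgroup has an element of order [p ^ e], where [e] exceeds the exponent of [p] in
   [n] by one. Nonemptiness of [D] will give [k < p]. *)
have [y Dy] : exists y, y \in D.
  set e := (logn p n).+1.
  have lognp : logn p (n * p) = e by rewrite lognM ?(prime_gt0 pr_p) // (logn_prime p pr_p) eqxx addn1.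
  have [P sylP] := Sylow_exists p G.
  have /cyclicP[x defP] := forall_inP ZG P (p_Sylow sylP).
  have ox : #[x] = (p ^ logn p #|G|)%N.
    by rewrite orderE -defP (card_Hall sylP) p_part.
  have le_e : e <= logn p #|G| by rewrite -lognp dvdn_leq_log.
  have oy : #[x ^+ (p ^ (logn p #|G| - e))] = (p ^ e)%N.
    by rewrite (orderXexp _ ox) subKn.
  exists (x ^+ (p ^ (logn p #|G| - e))); rewrite !inE -!order_dvdn oy.
  rewrite groupX ?(subsetP (pHall_sub sylP)) ?defP ?cycle_id //=.
  by rewrite !pfactor_dvdn ?muln_gt0 ?n_gt0 ?(prime_gt0 pr_p) // lognp leqnn ltnn.
(* Group [D] by generated subgroup: each class consists of the [totient #[z]] generators of some
   [<[z]>], and [p] divides [#[z]]. *)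
have dv_pD : p.-1 %| #|D|.
  rewrite -sum1_card (partition_big_imset (@cycle gT)).
  apply: dvdn_sum => _ /imsetP[z Dz ->].
  have [Gz znp zn] : [/\ z \in G, #[z] %| n * p & ~~ (#[z] %| n)].
    by move: Dz; rewrite !inE -!order_dvdn andbC => /andP[/andP[-> ->]].
  have p_z : p %| #[z].
    apply: contraR zn; rewrite -prime_coprime // => co_pz.
    by rewrite coprime_sym in co_pz; rewrite -(Gauss_dvdl n co_pz).
  rewrite (_ : \sum_(x in D | _) 1 = totient #[z]).
    rewrite totientE // (big_rem p) /=; last by rewrite mem_primes pr_p order_gt0.
    by rewrite -mulnA dvdn_mulr.
  rewrite totient_gen sum1dep_card; apply: eq_card => x.
  rewrite !inE /generator [RHS]eq_sym -!order_dvdn; apply: andb_idl => /eqP zx.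
  by rewrite !orderE zx -orderE znp (negPf zn) -cycle_subG zx cycle_subG Gz.
have k_gt0 : 0 < k.
  have: 0 < #|'Ldiv_n(G)| by apply/card_gt0P; exists 1; rewrite !inE group1 expg1n /=.
  by rewrite card_n muln_gt0 => /andP[].
have lt_kp : k < p.
  have: 0 < #|D| by apply/card_gt0P; exists y.
  by rewrite card_D muln_gt0 subn_gt0 => /andP[].
have co_pn : coprime p.-1 n.
  have p1_gt0 : 0 < p.-1 by rewrite -subn1 subn_gt0 prime_gt1.
  rewrite (coprime_has_primes p1_gt0 n_gt0).
  apply/hasPn=> q q_n; rewrite mem_primes p1_gt0; apply/andP=> -[_ /dvdn_leq].
  move/(_ p1_gt0); apply/negP; rewrite -ltnNge (leq_trans _ (le_pn q q_n)) //.
  by rewrite prednK ?prime_gt0.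
move: dv_pD; rewrite card_D (Gauss_dvdl _ co_pn) => /dvdn_leq.
rewrite subn_gt0 => /(_ lt_kp) le_pk.
suffices k1 : k = 1%N by rewrite card_n k1 mul1n.
apply/eqP; rewrite eqn_leq k_gt0 andbT.
rewrite leqNgt; apply: contraL le_pk => k_gt1.
by rewrite -ltnNge -subn1 ltn_sub2l ?(prime_gt1 pr_p).
Qed.

(** For the largest prime, [card_Ldiv_upper] identifies a Sylow subgroup [P] with the solutions of
    [x ^+ #|P| = 1] in [G], so [P] is normal; [P] being cyclic, its subgroup of prime order is
    characteristic. *)
Lemma Zgroup_normal_prime (gT : finGroupType) (G : {group gT}) :
    Zgroup G -> G :!=: 1 ->
  exists2 N : {group gT}, N <| G & prime #|N|.
Proof.
move=> ZG ntG; set p := max_pdiv #|G|.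
have pr_p : prime p by rewrite max_pdiv_prime ?cardG_gt1.
have [P sylP] := Sylow_exists p G; have sPG := pHall_sub sylP.
have cardP := card_Hall sylP.
have pG : p \in primes #|G| by rewrite mem_primes pr_p cardG_gt0 max_pdiv_dvd.
have logp : 0 < logn p #|G| by rewrite logn_gt0.
have card_n : #|'Ldiv_(#|P|)(G)| = #|P|.
  apply: card_Ldiv_upper ZG (cardSg sPG) _ => r q r_dv.
  rewrite cardP p_part primesX // primes_prime // inE => /eqP->.
  apply: max_pdiv_max; move: r_dv; rewrite !mem_primes => /and3P[-> _ r_dv].
  by rewrite cardG_gt0 (dvdn_trans r_dv) // dvdn_div // cardSg.
have defP : P :=: 'Ldiv_(#|P|)(G).
  apply/eqP; rewrite eqEcard card_n leqnn andbT subsetI sPG.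
  by apply/subsetP=> x Px; rewrite inE expg_cardG.
have nsPG : P <| G.
  apply/andP; split=> //; apply/subsetP=> g Gg; rewrite inE.
  apply/subsetP=> _ /imsetP[x Px ->]; rewrite defP !inE -conjXg expg_cardG //.
  by rewrite conj1g eqxx andbT groupJ ?(subsetP sPG x Px).
have [|x Px ox] := @Cauchy _ p P pr_p.
  by rewrite cardP p_part -{1}(expn1 p) dvdn_exp2l.
exists <[x]>%G; last by rewrite -orderE ox.
have cycP : cyclic P := forall_inP ZG P (p_Sylow sylP).
by apply: char_normal_trans nsPG; rewrite sub_cyclic_char ?cycle_subG.
Qed.

Lemma Frobenius_compl_normal_prime (gT : finGroupType) (L K M : {group gT}) :
    [Frobenius L = K ><| M] ->
  exists2 N : {group gT}, N <| M & prime #|N|.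
Proof.
move=> frobL; have [_ _ ntM _ _] := Frobenius_context frobL.
have [oddM | evenM] := boolP (odd #|M|).
  apply: Zgroup_normal_prime ntM; apply/forall_inP=> P /SylowP[p pr_p sylP].
  have sPM := pHall_sub sylP.
  rewrite (odd_pgroup_rank1_cyclic (pHall_pgroup sylP)); last first.
    by apply: dvdn_odd oddM; apply: cardSg.
  rewrite leqNgt; apply/negP=> /p_rank_geP[E /pnElemP[sEP abelE rkE]].
  have cycE : cyclic E.
    apply: Frobenius_compl_abelian_cyclic frobL _ (abelem_abelian abelE).
    exact: subset_trans sPM.
  by have := abelem_cyclic abelE; rewrite cycE rkE.
have [|t Mt ot] := @Cauchy _ 2 M isT.
  by rewrite dvdn2.
exists <[t]>%G; last by rewrite -orderE ot.
rewrite /normal cycle_subG Mt; apply/subsetP=> g Mg.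
rewrite inE -cycleJ.
by rewrite (Frobenius_compl_involution_uniq frobL (groupJ Mt Mg) Mt) ?orderJ.
Qed.

(** * Transfer along isomorphisms *)

Lemma frobenius_complement_isog (gT hT : finGroupType) (G : {group gT})
    (H : {group hT}) :
  G \isog H -> frobenius_complement G -> frobenius_complement H.
Proof.
move=> isoGH [G1 | [lT [L [K [M [frobL isoMG]]]]]]; [left | right].
  by apply/eqP; rewrite -(isog_eq1 isoGH) G1.
by exists lT, L, K, M; split; last exact: isog_trans isoMG isoGH.
Qed.

Lemma frobenius_complement_abelian_cyclic (gT : finGroupType)
    (G E : {group gT}) :
  frobenius_complement G -> E \subset G -> abelian E -> cyclic E.
Proof.
case=> [-> sE1 _ | [lT [L [K [M [frobL]]]]]].
  by have /trivgP-> := sE1; apply: cyclic1.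
rewrite isog_sym => /isogP[f injf defM] sEG cEE.
rewrite -(injm_cyclic injf sEG).
apply: Frobenius_compl_abelian_cyclic frobL _ _; last exact: morphim_abelian.
by rewrite -defM morphimS.
Qed.

Lemma frobenius_complement_prime_cent (gT : finGroupType)
    (G P Q : {group gT}) :
    frobenius_complement G -> P \subset G -> Q \subset G ->
    prime #|P| -> prime #|Q| -> P \subset 'N(Q) ->
  P \subset 'C(Q).
Proof.
case=> [-> /trivgP-> | [lT [L [K [M [frobL]]]]]]; first by move=> *; apply: sub1G.
rewrite isog_sym => /isogP[f injf defM] sPG sQG pr_P pr_Q nQP.
suffices: f @* P \subset 'C(f @* Q) by rewrite injm_cents.
apply: (Frobenius_compl_prime_cent (P := f @* P) (Q := f @* Q) frobL).
- by rewrite -defM morphimS.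
- by rewrite -defM morphimS.
- by rewrite /= card_injm.
- by rewrite /= card_injm.
exact: morphim_norms.
Qed.

Lemma frobenius_complement_normal_prime (gT : finGroupType) (G : {group gT}) :
    frobenius_complement G -> G :!=: 1 ->
  exists2 N : {group gT}, N <| G & prime #|N|.
Proof.
case=> [-> /eqP // | [lT [L [K [M [frobL isoMG]]]]] _].
have [N nsNM pr_N] := Frobenius_compl_normal_prime frobL.
have [f injf <-] := isogP isoMG.
exists (f @* N)%G; first exact: morphim_normal.
by rewrite /= card_injm ?(normal_sub nsNM).
Qed.

(** * Induction on the order for (iii) => (i) *)

Lemma frobenius_complement_prime_normal (gT : finGroupType)
    (G : {group gT}) (x : gT) :
    frobenius_complement G ->
    (forall N : {group gT}, N <| G -> N :!=: 1 -> dedekind_group (G / N)%G) ->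
    x \in G -> prime #[x] ->
  <[x]> <| G.
Proof.
move=> fcG dedGq Gx pr_x.
have ntG : G :!=: 1.
  by apply/trivgPn; exists x; rewrite // -order_gt1 prime_gt1.
have [N nsNG pr_N] := frobenius_complement_normal_prime fcG ntG.
have [sNG nNG] := andP nsNG; have sxG : <[x]> \subset G by rewrite cycle_subG.
have nNx := subset_trans sxG nNG.
have cNx : <[x]> \subset 'C(N) by apply: frobenius_complement_prime_cent fcG _ _ _ _ _.
have sEG : N <*> <[x]> \subset G by rewrite join_subG sNG.
have cycE : cyclic (N <*> <[x]>).
  apply: frobenius_complement_abelian_cyclic fcG sEG _.
  by rewrite abelianY cycle_abelian (cyclic_abelian (prime_cyclic pr_N)).
have nsEG : N <*> <[x]> <| G.
  have ntN : N :!=: 1 by rewrite -cardG_gt1 prime_gt1.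
  have nsE : (N <*> <[x]>) / N <| G / N.
    by apply: (dedGq N nsNG ntN ((N <*> <[x]>) / N)%G); rewrite quotientS.
  have nsNE : N <| N <*> <[x]> by rewrite normalYl.
  by rewrite -(quotientGK nsNE) -(quotientGK nsNG) cosetpre_normal.
by apply: char_normal_trans nsEG; rewrite sub_cyclic_char ?joing_subr.
Qed.

Lemma dedekind_quotient (gT : finGroupType) (G N : {group gT}) :
  N <| G -> dedekind_group G -> dedekind_group (G / N)%G.
Proof.
move=> nsNG dedG Hbar /(inv_quotientS nsNG)[H -> _ sHG].
by apply: quotient_normal; apply: dedG.
Qed.

(** The type of [G / A] depends on [A], so the two quotients are compared by isomorphism. *)
Lemma isog_quotient_eq (gT : finGroupType) (G : {group gT}) (A B : {set gT}) :
  A = B -> G / A \isog G / B.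
Proof. by move->; apply: isog_refl. Qed.

Lemma frobenius_complement_images_dedekind (F : fieldType)
    (gT : finGroupType) (G : {group gT}) :
    ([pchar F]%R)^'.-group G ->
    (forall n (rG : mx_representation F G n),
        mx_irreducible rG -> frobenius_complement (G / rker rG)%G) ->
  dedekind_group G.
Proof.
have [m] := ubnP #|G|; elim: m gT G => // m IHm gT G le_m chG fcG.
have dedGq (N : {group gT}) : N <| G -> N :!=: 1 -> dedekind_group (G / N)%G.
  move=> nsNG ntN; have nNG := normal_norm nsNG.
  apply: IHm; first by rewrite (leq_trans (ltn_quotient ntN (normal_sub nsNG))).
    exact: quotient_pgroup.
  (* Inflating [rGN] to [G] does not change its image up to isomorphism. *)
  move=> n rGN irrGN; pose rG := morphim_repr rGN nNG.
  have irrG : mx_irreducible rG by apply/morphim_mx_irr.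
  apply: frobenius_complement_isog (fcG n rG irrG).
  have sNker : N \subset rker rG.
    by rewrite rker_morphim subsetI normal_sub //= sub_cosetpre.
  have def_ker : rker rG / N = rker rGN.
    rewrite rker_morphim quotientGI ?normal_sub // cosetpreK.
    exact/setIidPr/normal_sub/rker_normal.
  rewrite isog_sym; apply: isog_trans (third_isog sNker nsNG (rker_normal rG)).
  by apply: isog_quotient_eq.
apply: (fpf_dedekind chG) => n rG irrG.
have [ker1 | nt_ker] := eqVneq (rker rG) 1%G.
  have fcG1 : frobenius_complement G.
    apply: frobenius_complement_isog (fcG n rG irrG).
    by rewrite isog_sym ker1; apply: quotient1_isog.
  move=> g Gg; have [-> | ntg] := eqVneq g 1; first by left; apply: repr_mx1.
  (* A vector fixed by [g] is fixed by its power [x] of prime order, and [<[x]>] is normal. *)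
  right=> v vg; have pr_p : prime (pdiv #[g]) by rewrite pdiv_prime ?order_gt1.
  have [x gx ox] := Cauchy pr_p (pdiv_dvd _).
  have Gx : x \in G by apply: subsetP gx; rewrite cycle_subG.
  have nsxG : <[x]> <| G.
    by apply: frobenius_complement_prime_normal; rewrite ?ox.
  have [rx1 | fixx] := irr_normal_cycle_fpf irrG nsxG.
    have: x \in rker rG by apply/rkerP.
    by rewrite ker1 => /set1P x1; rewrite -ox x1 order1 in pr_p.
  apply: fixx; have /cycleP[i ->] := gx.
  elim: i => [|i IHi]; first by rewrite repr_mx1 mulmx1.
  by rewrite expgSr repr_mxM ?groupX // mulmxA IHi.
move=> g Gg; rewrite -(kquo_repr_coset rG Gg).
apply: (dedekind_irr_fpf (dedGq _ (rker_normal rG) nt_ker)).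
  exact/quo_mx_irr.
exact: mem_quotient.
Qed.

(** * The implication (ii) => (iii) and the equivalence *)

Lemma fpf_images_frobenius_complement (F : fieldType) (gT : finGroupType)
    (G : {group gT}) (n : nat) (rG : mx_representation F G n) :
    dedekind_group G -> mx_irreducible rG ->
  frobenius_complement (G / rker rG)%G.
Proof.
move=> dedG irrG; have n_gt0 : 0 < n by case/mx_irrP: irrG.
set H := (G / rker rG)%G.
have dedH : dedekind_group H by apply: dedekind_quotient (rker_normal rG) dedG.
have irrH : mx_irreducible (kquo_repr rG) by apply/quo_mx_irr.
have regH : semireg_repr (kquo_repr rG).
  apply: fpf_faithful_semireg (kquo_mx_faithful rG).
  exact: dedekind_irr_fpf.
(* A prime above [#|H|] does not divide it, so Maschke applies over ['F_q]; the field is finite so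
   that the module can serve as a Frobenius kernel. *)
have [q ltHq pr_q] := prime_above #|H|.
have chH : ([pchar 'F_q]%R)^'.-group H.
  rewrite /pgroup (eq_pnat _ (eq_negn (pcharf_eq (pchar_Fp pr_q)))) p'natE //.
  by apply: contraL ltHq => /dvdn_leq; rewrite cardG_gt0 -leqNgt => ->.
have [r [rH [irr_rH ff_rH]]] :=
  faithful_irr_exists chH (dedekind_semireg_prime_cycle dedH n_gt0 regH).
have [r_gt0 _] := (mx_irrP _).1 irr_rH.
apply: (semireg_frobenius r_gt0 (rG := rH)).
exact: fpf_faithful_semireg (dedekind_irr_fpf dedH irr_rH) ff_rH.
Qed.

(** The image of [rG] enters as the isomorphic quotient [G / rker rG]. *)
Theorem theorem5p10 (F : fieldType) (gT : finGroupType) (G : {group gT})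
    (hchar : ([pchar F]%R)^'.-group G) :
  (dedekind_group G <->
     (forall (n : nat) (rG : mx_representation F G n),
        mx_irreducible rG -> fpf_repr rG)) /\
  ((forall (n : nat) (rG : mx_representation F G n),
        mx_irreducible rG -> fpf_repr rG) <->
     (forall (n : nat) (rG : mx_representation F G n),
        mx_irreducible rG -> frobenius_complement (G / rker rG)%G)).
Proof.
split; split.
- by move=> dedG n rG; apply: dedekind_irr_fpf.
- exact: fpf_dedekind.
- by move=> fpfG n rG; apply: fpf_images_frobenius_complement (fpf_dedekind hchar fpfG).
move=> fcG n rG; apply: dedekind_irr_fpf.
exact: frobenius_complement_images_dedekind fcG.
Qed.
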